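(* Let $X$ be a finite set and let $\varnothing\neq Z\subseteq Y\subseteq X$ with $|X|=n$, $|Y|=m$ and $|Z|=k$. Then $$|\mathrm{Reg}(\mathcal{T}(X,Y,Z))|=\sum_{r=1}^{k}\binom{k}{r}\,r!\,S(k,r)\,r^{m-k}\,(n-m+r)^{n-m}.$$
   Context: $\mathcal{T}(X)$ is the full transformation semigroup on $X$ (all maps $X\to X$ under composition). Maps are written on the right, so $x(\alpha\beta)=(x\alpha)\beta$, and $A\alpha=\{a\alpha : a\in A\}$ for $A\subseteq X$. For $\varnothing\neq Z\subseteq Y\subseteq X$, $\mathcal{T}(X,Y,Z)=\{\alpha\in\mathcal{T}(X): Y\alpha\subseteq Z\}$, a subsemigroup of $\mathcal{T}(X)$. An element $x$ of a semigroup $S$ is regular in $S$ if $x=xyx$ for some $y\in S$; $\mathrm{Reg}(S)$ is the set of regular elements of $S$. $S(p,r)$ is the Stirling number of the second kind, the number of partitions of a $p$-element set into $r$ nonempty (indistinguishable) blocks. The convention $x^0=1$ is used. *)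

(* Defs.v *)
From HB Require Import structures.
From mathcomp Require Import all_boot all_fingroup.

Set Implicit Arguments.
Unset Strict Implicit.
Unset Printing Implicit Defensive.

Local Open Scope group_scope.

Definition transf (X : finType) := {ffun X -> X}.

Section Transformations.
Variable X : finType.

HB.instance Definition _ := Finite.on (transf X).

(* Maps are written on the right: a * b applies a first, then b. *)
Definition transf_mul (a b : transf X) : transf X := [ffun x => b (a x)].

Lemma transf_mulA : associative transf_mul.
Proof. by move=> a b c; apply/ffunP => x; rewrite !ffunE. Qed.

HB.instance Definition _ := isSemigroup.Build (transf X) transf_mulA.

Lemma transf_mulE (a b : transf X) x : (a * b) x = b (a x).
Proof. by rewrite ffunE. Qed.

Definition transf_YZ (Y Z : {set X}) : {set transf X} :=
  [set a : transf X | a @: Y \subset Z].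

Lemma transf_YZ_mulg_closed (Y Z : {set X}) :
  Z \subset Y -> mulg_closed (transf_YZ Y Z).
Proof.
move=> sZY a b; rewrite !inE => aYZ bYZ; apply/subsetP => _ /imsetP[x Yx ->].
rewrite transf_mulE; apply: (subsetP bYZ); apply: imset_f.
by apply: (subsetP sZY); apply: (subsetP aYZ); apply: imset_f.
Qed.

(* The pseudo-inverse y is required to lie in S itself. *)
Definition Reg (S : {set transf X}) : {set transf X} :=
  [set x in S | [exists y in S, x == x * y * x]].

End Transformations.

Definition stirling2 (p r : nat) : nat :=
  #|[set P : {set {set 'I_p}} | partition P [set: 'I_p] & #|P| == r]|.

(* Main.v *)
Require Import Defs.
From mathcomp Require Import all_boot.

(* A map a is regular exactly when Ya is in Z and every point of Y in the image
   of a already lies in Za.  With A = Za, this says that A is a subset of Z, that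
   a sends Y into A, and that a sends the complement of Y into A together with
   the complement of Y.  For a given A of size r there are r! S(k,r) choices for
   the restriction of a to Z (it must be onto A), r choices at each of the m - k
   points of Y \ Z, and n - m + r choices at each of the n - m points outside Y. *)

(* A surjection onto 'I_r is recorded by its fibers, that is, by an injective
   enumeration of the blocks of a partition. *)
Lemma card_surj_ord p r :
  #|[set f : {ffun 'I_p -> 'I_r} | f @: setT == setT]| = r`! * stirling2 p r.
Proof.
pose fibers (f : {ffun 'I_p -> 'I_r}) := [ffun i => f @^-1: [set i]].
have fibers_inj : injective fibers.
  move=> f g /ffunP eq_fg; apply/ffunP => x; have := eq_fg (g x).
  rewrite !ffunE => /setP/(_ x); rewrite !inE eqxx.
  by move=> /eqP.
rewrite -(card_imset _ fibers_inj).
pose S := [set P : {set {set 'I_p}} | partition P [set: 'I_p] & #|P| == r].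
pose H := [set h : {ffun 'I_r -> {set 'I_p}} |
             injectiveb h & partition (h @: setT) setT].
have -> : fibers @: [set f : {ffun 'I_p -> 'I_r} | f @: setT == setT] = H.
  apply/setP => h; apply/imsetP/idP => [[f + ->]|].
    rewrite !inE => /eqP f_surj.
    have ne i : exists x, f x = i.
      have : i \in f @: setT by rewrite f_surj inE.
      by case/imsetP => x _ ->; exists x.
    apply/andP; split.
      apply/injectiveP => i j; rewrite !ffunE => /setP eq_ij.
      have [x fx] := ne i; have := eq_ij x; rewrite !inE fx eqxx.
      by move/esym/eqP.
    apply/and3P; split.
    - rewrite eqEsubset subsetT; apply/subsetP => x _; apply/bigcupP.
      by exists (fibers f (f x)); rewrite ?imset_f // ffunE !inE.
    - apply/trivIsetP => _ _ /imsetP[i _ ->] /imsetP[j _ ->].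
      rewrite !ffunE => neq_ij; rewrite -setI_eq0; apply/set0Pn => -[x].
      rewrite !inE => /andP[/eqP fxi /eqP fxj].
      by move: neq_ij; rewrite -fxi -fxj eqxx.
    - apply/imsetP => -[i _]; rewrite ffunE => /setP eq0.
      by have [x fx] := ne i; have := eq0 x; rewrite !inE fx eqxx.
  rewrite inE => /andP[/injectiveP h_inj /and3P[/eqP cov triv n0]].
  (* The map is rebuilt from [h]: covering gives each point an index, disjointness of the blocks and
     injectivity of [h] make it unique, and nonemptiness of the blocks makes the map onto. *)
  have ex x : exists i, x \in h i.
    have : x \in cover (h @: setT) by rewrite cov inE.
    by case/bigcupP => _ /imsetP[i _ ->]; exists i.
  have uniq_h x i j : x \in h i -> x \in h j -> i = j.
    move=> xi xj; apply: h_inj; apply/eqP; apply: contraT => neq.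
    have := trivIsetP triv _ _ (imset_f h (in_setT i)) (imset_f h (in_setT j)) neq.
    by move/disjointFr/(_ xi); rewrite xj.
  pose f := [ffun x => xchoose (ex x)].
  have fP x i : (f x == i) = (x \in h i).
    rewrite ffunE; apply/eqP/idP => [<-|xi]; first exact: (xchooseP (ex x)).
    by apply: (uniq_h x) => //; exact: (xchooseP (ex x)).
  exists f; last by apply/ffunP => i; apply/setP => x; rewrite ffunE !inE fP.
  rewrite inE eqEsubset subsetT; apply/subsetP => i _.
  have /set0Pn[x] : h i != set0.
    by apply: contraNneq n0 => <-; rewrite imset_f.
  by rewrite -fP => /eqP <-; rewrite imset_f.
(* Group the enumerations by the partition [P] they enumerate: each [P] with [r] blocks has [r]! of
   them, an injection from ['I_r] into [P] being automatically onto. *)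
rewrite -sum1_card (partition_big (fun h : {ffun _ -> _} => h @: setT) [in S]) /=.
  rewrite (eq_bigr (fun=> r`!)); first by rewrite sum_nat_const mulnC.
  move=> P; rewrite inE => /andP[partP /eqP cardP].
  have := card_inj_ffuns_on 'I_r [in P].
  rewrite sum1_card card_ord cardP ffactnn => <-.
  apply: eq_card => h; rewrite [in RHS]inE unfold_in /= inE; apply/idP/idP.
    case/andP=> /andP[inj_h _] /eqP <-; rewrite inj_h andbT.
    by apply/ffun_onP => i; rewrite imset_f.
  case/andP => /ffun_onP hP inj_h; rewrite inj_h /=.
  have h_onto : h @: setT = P.
    apply/eqP; rewrite eqEcard cardP card_imset ?cardsT ?card_ord ?leqnn ?andbT //.
      by apply/subsetP => _ /imsetP[i _ ->].
    exact/injectiveP.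
  by rewrite h_onto partP eqxx.
move=> h; rewrite !inE => /andP[/injectiveP inj_h ->] /=.
by rewrite card_imset // cardsT card_ord.
Qed.

(** Composition with [enum_val], which identifies ['I_#|A|] with [A], reduces this to surjections
    onto an ordinal. *)
Lemma card_ffun_onto (T : finType) (A : {set T}) p :
  #|[set f : {ffun 'I_p -> T} | f @: setT == A]| = #|A|`! * stirling2 p #|A|.
Proof.
rewrite -card_surj_ord.
pose incl (f : {ffun 'I_p -> 'I_#|A|}) : {ffun 'I_p -> T} :=
  [ffun i => enum_val (f i)].
have incl_inj : injective incl.
  move=> f g /ffunP eq_fg; apply/ffunP => i.
  by have := eq_fg i; rewrite !ffunE => /enum_val_inj.
rewrite -(card_imset _ incl_inj); apply: eq_card => f; rewrite inE.
apply/eqP/imsetP => [fA|[g + ->]].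
  have fP i : f i \in A by rewrite -fA imset_f.
  pose g := [ffun i => enum_rank_in (fP i) (f i)].
  have gK i : enum_val (g i) = f i by rewrite ffunE enum_rankK_in.
  exists g; last by apply/ffunP => i; rewrite [RHS]ffunE gK.
  rewrite inE eqEsubset subsetT; apply/subsetP => j _.
  have : enum_val j \in f @: setT by rewrite fA enum_valP.
  by case/imsetP => i _; rewrite -gK => /enum_val_inj ->; rewrite imset_f.
rewrite inE => /eqP g_surj; apply/setP => y; apply/imsetP/idP => [[i _ ->]|yA].
  by rewrite ffunE enum_valP.
have : enum_rank_in yA y \in g @: setT by rewrite g_surj inE.
by case/imsetP => i _ eq_i; exists i; rewrite ?ffunE -?eq_i ?enum_rankK_in.
Qed.

Section Regular.
Variables (X : finType) (Y Z : {set X}).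
Hypotheses (Z_neq0 : Z != set0) (sZY : Z \subset Y).

(** If a = aba and xa lies in Y, then xa = ((xa)b)a with (xa)b in Z. Conversely, a pseudo-inverse
    chooses preimages under a, taking them in Z for points of Y. *)
Lemma Reg_transf_YZE (a : transf X) :
  (a \in Reg (transf_YZ Y Z)) =
  (a @: Y \subset Z) && (a @: setT :&: Y \subset a @: Z).
Proof.
rewrite !inE; case aYZ: (a @: Y \subset Z) => //=.
apply/existsP/subsetP => [[b /andP[bYZ /eqP aba]] y|aY].
  rewrite inE => /andP[/imsetP[x _ ->] axY].
  have -> : a x = a (b (a x)) by rewrite {1}aba !transf_mulE.
  apply: imset_f.
  by move: bYZ; rewrite inE => /subsetP; apply; rewrite imset_f.
have [z0 z0Z] := set0Pn _ Z_neq0.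
(* The default [z0] lies in Z, so [b] sends Y into Z even at points of Y without a preimage in Z. *)
pose b : transf X := [ffun y =>
  if y \in Y then odflt z0 [pick z in Z | a z == y]
  else odflt z0 [pick x | a x == y]].
exists b; rewrite inE; apply/andP; split.
  apply/subsetP => _ /imsetP[y yY ->]; rewrite ffunE yY.
  by case: pickP => [z /andP[]|].
apply/eqP/ffunP => x; rewrite !transf_mulE [b _]ffunE.
case: ifP => axY; case: pickP => /=.
- by move=> z /andP[_ /eqP ->].
- have : a x \in a @: Z by apply: aY; rewrite inE axY imset_f.
  by case/imsetP => z zZ -> /(_ z); rewrite zZ eqxx.
- by move=> z /eqP ->.
- by move/(_ x); rewrite eqxx.
Qed.

Definition codomain_at (A : {set X}) (x : X) : {set X} :=
  if x \in Y then A else A :|: ~: Y.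

(** Once the image A of Z is fixed, the condition is pointwise, so the values outside Z can be
    chosen independently. *)
Lemma Reg_transf_YZ_codomain (a : transf X) :
  (a \in Reg (transf_YZ Y Z)) =
  (a @: Z \subset Z) && [forall x, a x \in codomain_at (a @: Z) x].
Proof.
rewrite Reg_transf_YZE; apply/andP/andP => [[/subsetP aYZ /subsetP aY]|].
  split; first by apply/subsetP => y /(subsetP (imsetS a sZY))/aYZ.
  apply/forallP => x; rewrite /codomain_at; case: ifP => xY.
    have axZ : a x \in Z by rewrite aYZ ?imset_f.
    by rewrite aY // inE imset_f // (subsetP sZY).
  rewrite !inE; case axY: (a x \in Y); last by rewrite orbT.
  by rewrite aY // inE axY imset_f.
case=> aZZ /forallP aP; split.
  apply/subsetP => _ /imsetP[y yY ->]; apply: (subsetP aZZ).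
  by have := aP y; rewrite /codomain_at yY.
apply/subsetP => _ /setIP[/imsetP[x _ ->] axY].
by have := aP x; rewrite /codomain_at; case: ifP; rewrite // !inE axY orbF.
Qed.

Lemma card_codomain_at (A : {set X}) :
  A \subset Z ->
  #|[set a : {ffun X -> X} |
      (a @: Z == A) && [forall x, a x \in codomain_at A x]]| =
  #|A|`! * stirling2 #|Z| #|A| * #|A| ^ (#|Y| - #|Z|)
    * (#|X| - #|Y| + #|A|) ^ (#|X| - #|Y|).
Proof.
move=> sAZ; have [z0 z0Z] := set0Pn _ Z_neq0.
(* The restriction to Z, reindexed by an ordinal so that [card_ffun_onto] counts its possible
   values. *)
pose res (a : {ffun X -> X}) := [ffun i : 'I_#|Z| => a (enum_val i)].
have res_im a : res a @: setT = a @: Z.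
  apply/setP => y; apply/imsetP/imsetP => [[i _ ->]|[z zZ ->]].
    by exists (enum_val i); rewrite ?enum_valP ?ffunE.
  by exists (enum_rank_in z0Z z); rewrite ?ffunE ?enum_rankK_in.
rewrite -sum1_card (partition_big res
  [in [set f : {ffun 'I_#|Z| -> X} | f @: setT == A]]) /=; last first.
  by move=> a; rewrite !inE res_im => /andP[].
rewrite (eq_bigr (fun=> #|A| ^ (#|Y| - #|Z|)
    * (#|X| - #|Y| + #|A|) ^ (#|X| - #|Y|))).
  by rewrite sum_nat_const card_ffun_onto !mulnA.
move=> f; rewrite inE => /eqP fA.
(* The maps restricting to a given [f] form a product: one value on Z, any value in
   [codomain_at A x] elsewhere. *)
pose F x : {set X} := if x \in Z then [set f (enum_rank_in z0Z x)]
                      else codomain_at A x.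
rewrite sum1_card; transitivity #|family F|.
  apply: eq_card => a; rewrite unfold_in /= inE -andbA.
  apply/and3P/familyP => [[/eqP aZ /forallP aP /eqP af] x|aF].
    rewrite /F; case: ifP => xZ; last exact: aP.
    by rewrite -af ffunE enum_rankK_in ?inE.
  have af : res a = f.
    apply/ffunP => i; rewrite ffunE; have := aF (enum_val i).
    by rewrite /F enum_valP inE enum_valK_in => /eqP.
  have aZ : a @: Z = A by rewrite -res_im af.
  split; rewrite ?af ?aZ //; apply/forallP => x; have := aF x.
  rewrite /F; case: ifP => // xZ _.
  by rewrite /codomain_at (subsetP sZY) // -aZ imset_f.
rewrite card_family foldrE big_map big_enum /=.
(* Split the product over Z, Y \ Z and the complement of Y; the first factor is 1. *)
rewrite (bigID [in Y]) (bigID [in Z]) /=.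
rewrite big1 ?mul1n => [|x /andP[_ xZ]]; last by rewrite /F xZ cards1.
congr (_ * _).
  rewrite (eq_bigr (fun=> #|A|)) => [|x /andP[xY /negPf xZ]]; last first.
    by rewrite /F xZ /codomain_at xY.
  rewrite prod_nat_const; congr (_ ^ _).
  have -> : #|Y| - #|Z| = #|Y :\: Z| by rewrite cardsD (setIidPr sZY).
  by apply: eq_card => x; rewrite !inE andbC.
have cardCY : #|~: Y| = #|X| - #|Y| by rewrite cardsCs setCK.
rewrite (eq_bigr (fun=> #|X| - #|Y| + #|A|)) => [|x xY].
  rewrite prod_nat_const; congr (_ ^ _); rewrite -cardCY.
  by apply: eq_card => x; rewrite !inE.
have /negPf xZ : x \notin Z by apply: contra xY; apply: (subsetP sZY).
(* The cardinals add up because A, contained in Y, is disjoint from [~: Y]. *)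
rewrite /F xZ /codomain_at (negPf xY) -cardCY addnC cardsU.
rewrite [A :&: _](_ : _ = set0) ?cards0 ?subn0 //.
by apply/eqP; rewrite setI_eq0 disjoints_subset setCK (subset_trans sAZ).
Qed.

End Regular.

Theorem theorem4p5 (X : finType) (Y Z : {set X}) (n m k : nat)
    (Z_neq0 : Z != set0) (sZY : Z \subset Y)
    (cardX : #|X| = n) (cardY : #|Y| = m) (cardZ : #|Z| = k) :
  #|Reg (transf_YZ Y Z)| =
  \sum_(1 <= r < k.+1)
    'C(k, r) * r`! * stirling2 k r * r ^ (m - k) * (n - m + r) ^ (n - m).
Proof.
pose N r := r`! * stirling2 k r * r ^ (m - k) * (n - m + r) ^ (n - m).
have im_neq0 (a : transf X) : a @: Z != set0.
  by have [z zZ] := set0Pn _ Z_neq0; apply/set0Pn; exists (a z); rewrite imset_f.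
(* Sort the regular maps by the image A of Z, which is nonempty; hence the sum starts at r = 1. *)
rewrite -sum1_card (partition_big (fun a : transf X => a @: Z)
  (fun A => (A \subset Z) && (A != set0))) /=; last first.
  by move=> a; rewrite Reg_transf_YZ_codomain // => /andP[-> _]; apply: im_neq0.
rewrite (eq_bigr (fun A : {set X} => N #|A|)) => [|A /andP[sAZ A_neq0]]; last first.
  rewrite sum1_card /N -cardX -cardY -cardZ -(card_codomain_at _ _ _ Z_neq0 sZY _ sAZ).
  apply: eq_card => a; rewrite unfold_in /= Reg_transf_YZ_codomain // inE.
  by rewrite andbC; case: eqP => //= ->; rewrite sAZ.
have A_gt0 (A : {set X}) : A != set0 -> 0 < #|A| by rewrite card_gt0.
have k_gt0 : 0 < k by rewrite -cardZ A_gt0.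
rewrite big_add1 /= big_mkord.
case: k k_gt0 cardZ @N => // k _ cardZ N.
(* Sort the sets A by size, shifted down by one: sizes run from 1 to |Z|, so the predecessor fits in
   the ordinal and [inord] does not truncate. *)
rewrite (partition_big (fun A : {set X} => inord #|A|.-1 : 'I_k.+1) xpredT) //=.
apply: eq_bigr => r _.
have cardP (A : {set X}) :
    [&& A \subset Z, A != set0 & inord #|A|.-1 == r] =
    (A \subset Z) && (#|A| == r.+1).
  case sAZ: (A \subset Z) => //=; have [->|A_neq0] /= := eqVneq A set0.
    by rewrite cards0.
  have := subset_leq_card sAZ; rewrite cardZ; move: (A_gt0 A A_neq0).
  by case: #|A| => // c _ ltck; rewrite -val_eqE /= inordK // eqSS.
rewrite (eq_bigl (fun A : {set X} => (A \subset Z) && (#|A| == r.+1))); last first.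
  by move=> A; rewrite -andbA cardP.
rewrite (eq_bigr (fun=> N r.+1)) => [|A /andP[_ /eqP ->] //].
by rewrite sum_nat_const -cardsE cards_draws cardZ /N !mulnA.
Qed.
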